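(* Let $k>2$ and $\psi(x)=x^{k/2}$ for $x\ge0$. Then there is a constant $C_k>1$ such that for all $v,v_1\in\mathbb R^d$ with $u=v_1-v\ne0$ one can write $K_{2,\psi}=\widetilde G_{2,\psi}-\widetilde L_{2,\psi}$, where $\widetilde G_{2,\psi},\widetilde L_{2,\psi}$ (functions of $(v,v_1)$) satisfy $$0\le\widetilde G_{2,\psi}\le\alpha_{k/2}\,C_k\,\langle v\rangle\langle v_1\rangle\big(\langle v\rangle^{k-2}+\langle v_1\rangle^{k-2}\big),$$ $$\widetilde L_{2,\psi}\ge(\|b_2\|-\alpha_{k/2})\big(\langle v\rangle^k+\langle v_1\rangle^k\big).$$ Additionally, if $\psi_n\nearrow\psi$ is the approximating sequence defined in the context, then for every $n$ one can write $K_{2,\psi_n}=\widetilde G_{2,\psi_n}-\widetilde L_{2,\psi_n}$, where $$0\le\widetilde G_{2,\psi_n}\le\|b_2\|\,C_k\,\langle v\rangle\langle v_1\rangle\big(\langle v\rangle^{k-2}+\langle v_1\rangle^{k-2}\big),$$ $$\widetilde L_{2,\psi_n}\ge0,\qquad \widetilde L_{2,\psi_n}\to\widetilde L_{2,\psi}\ \text{ as } n\to\infty,$$ with the same constant $C_k$.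
   Context: Let $d\ge2$, $\langle v\rangle=\sqrt{1+|v|^2}$. Let $b_2:[-1,1]\to[0,\infty)$ be even with $b_2(z)(1-z^2)^{\frac{d-3}{2}}\in L^1([-1,1])$, and $\|b_2\|:=\int_{\mathbb S^{d-1}}b_2(\hat u\cdot\omega)\,d\omega<\infty$ (independent of the unit vector $\hat u$). For $v,v_1\in\mathbb R^d$ with $u=v_1-v\ne0$ and $\omega\in\mathbb S^{d-1}$, put $\hat u=u/|u|$, $v'=v+(\omega\cdot u)\omega$, $v_1'=v_1-(\omega\cdot u)\omega$. For a nonnegative function $\psi$ on $[0,\infty)$ set $K_{2,\psi}=G_{2,\psi}-L_{2,\psi}$, where $$G_{2,\psi}(v,v_1)=\int_{\mathbb S^{d-1}}b_2(\hat u\cdot\omega)\big(\psi(\langle v'\rangle^2)+\psi(\langle v_1'\rangle^2)\big)d\omega,$$ $$L_{2,\psi}(v,v_1)=\|b_2\|\big(\psi(\langle v\rangle^2)+\psi(\langle v_1\rangle^2)\big).$$ Binary coercive map (known result): $\{\alpha_{k/2}\}_{k\ge2}$ denotes a strictly decreasing map in $k$ with $\alpha_1=\|b_2\|$, $\alpha_{k/2}\to0$ as $k\to\infty$, such that for all $k\ge2$ and all $v\ne v_1$, $$\int_{\mathbb S^{d-1}}b_2(\hat u\cdot\omega)\big(\langle v'\rangle^k+\langle v_1'\rangle^k\big)d\omega\le\alpha_{k/2}\big(\langle v\rangle^2+\langle v_1\rangle^2\big)^{k/2}.$$ Approximating sequence: for $n\in\mathbb N$, $n\ge1$, $\psi_n(x)=\psi(x)$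 if $0\le x\le n$, and $\psi_n(x)=\psi'(n)x+\psi(n)-n\psi'(n)$ if $x>n$. *)

(* Defs.v *)
From HB Require Import structures.
From mathcomp Require Import all_boot all_order all_algebra.
From mathcomp Require Import all_classical all_reals all_analysis.
From mathcomp Require Import measurable_realfun.

Set Implicit Arguments.
Unset Strict Implicit.
Unset Printing Implicit Defensive.

Import Order.TTheory GRing.Theory Num.Theory.
Import numFieldNormedType.Exports.

Local Open Scope classical_set_scope.
Local Open Scope ring_scope.

(* 'rV[R]_n with the sigma-algebra generated by the coordinates, that is, the
   Borel sigma-algebra of R^n. *)
Section measurable_rV.
Context {R : realType} (n : nat).

Let coors : 'I_n -> 'rV[R]_n -> measurableTypeR R := fun i x => x ord0 i.

Let rV_set0 : g_sigma_preimage coors set0.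
Proof. exact: sigma_algebra0. Qed.

Let rV_setC A : g_sigma_preimage coors A -> g_sigma_preimage coors (~` A).
Proof. exact: sigma_algebraC. Qed.

Let rV_bigcup (F : _^nat) : (forall i, g_sigma_preimage coors (F i)) ->
  g_sigma_preimage coors (\bigcup_i (F i)).
Proof. exact: sigma_algebra_bigcup. Qed.

HB.instance Definition _ := @isMeasurable.Build default_measure_display
  'rV[R]_n (g_sigma_preimage coors) rV_set0 rV_setC rV_bigcup.

Lemma measurable_coord (i : 'I_n) :
  measurable_fun [set: 'rV[R]_n] (fun x : 'rV[R]_n => x ord0 i : measurableTypeR R).
Proof.
move=> _ Y mY; rewrite setTI; apply: sub_sigma_algebra => /=.
rewrite -bigcup_seq/=; exists i => /=; first by rewrite mem_index_enum.
by exists Y => //; rewrite setTI.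
Qed.

Lemma measurable_fun_coordP d (T : measurableType d) (f : T -> 'rV[R]_n) :
  measurable_fun [set: T] f <->
  forall i, measurable_fun [set: T] (fun x => f x ord0 i : measurableTypeR R).
Proof.
split=> [mf i|mf].
  exact: (measurableT_comp (measurable_coord i) mf).
suff sub : g_sigma_preimage coors `<=` [set B | measurable (f @^-1` B)].
  by move=> _ A mA; rewrite setTI; exact: sub.
apply: smallest_sub.
  split; first by rewrite /= preimage_set0.
    by move=> B /= mB; rewrite setTD -preimage_setC; exact: measurableC.
  by move=> F mF /=; rewrite preimage_bigcup;
    apply: bigcup_measurable => k _; exact: mF.
rewrite -bigcup_seq; apply: bigcup_sub => i _ _ [C mC <-] /=.
by rewrite setTI -comp_preimage -[X in measurable X]setTI; exact: mf.
Qed.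

End measurable_rV.

Definition image_measure d1 d2 (T1 : measurableType d1) (T2 : measurableType d2)
    (R : realType) (m : {measure set T1 -> \bar R}) (f : T1 -> T2)
    (mf : measurable_fun [set: T1] f) : {measure set T2 -> \bar R} :=
  measure_function_pushforward__canonical__measure_function_Measure m mf.

Section lebesgue_rV.
Context {R : realType}.

Definition cons_rV n (p : 'rV[R]_n * measurableTypeR R) : 'rV[R]_n.+1 :=
  row_mx (\row_(_ < 1) (p.2 : R)) p.1.

Lemma measurable_cons_rV n :
  measurable_fun [set: 'rV[R]_n * measurableTypeR R] (@cons_rV n).
Proof.
apply/measurable_fun_coordP => i; rewrite /cons_rV.
case: (@split_ordP 1 n i) => j ->.
  rewrite (_ : (fun _ => _) = snd); first exact: measurable_snd.
  by apply/funext => x; rewrite [LHS]row_mxEl mxE.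
rewrite (_ : (fun _ => _) = (fun x : 'rV[R]_n => x ord0 j) \o fst).
  exact: (measurableT_comp (measurable_coord j)).
by apply/funext => x; rewrite [LHS]row_mxEr.
Qed.

Fixpoint lebesgue_rV n : {measure set 'rV[R]_n -> \bar R} :=
  match n with
  | 0%N => dirac (0 : 'rV[R]_0)
  | m.+1 => image_measure (lebesgue_rV m \x lebesgue_measure)%E
                          (@measurable_cons_rV m)
  end.

End lebesgue_rV.

Section euclidean.
Context {R : realType} {d : nat}.
Implicit Types u v w : 'rV[R]_d.

Definition dot u v : R := \sum_i u ord0 i * v ord0 i.

(* The library's `|v| on 'rV[R]_d is the sup norm. *)
Definition enorm v : R := Num.sqrt (dot v v).

Definition normalize v : 'rV[R]_d := (enorm v)^-1 *: v.

Definition sphere : set 'rV[R]_d := [set w | enorm w = 1].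

Definition punctured_ball : set 'rV[R]_d := [set w | 0 < enorm w <= 1].

Lemma measurable_enorm : measurable_fun [set: 'rV[R]_d] enorm.
Proof.
have msqrt : measurable_fun [set: R] (@Num.sqrt R).
  by apply: continuous_measurable_fun; exact: sqrt_continuous.
apply: (measurableT_comp msqrt); apply: measurable_sum => i.
by apply: measurable_funM; exact: measurable_coord.
Qed.

Lemma measurable_normalize : measurable_fun [set: 'rV[R]_d] normalize.
Proof.
apply/measurable_fun_coordP => i.
rewrite (_ : (fun _ => _) = fun x => enorm x `^ (-1) * x ord0 i); last first.
  by apply/funext => x; rewrite mxE powR_inv1// sqrtr_ge0.
apply: measurable_funM; last exact: measurable_coord.
exact: (measurableT_comp (measurable_powR (-1)) measurable_enorm).
Qed.

Lemma measurable_punctured_ball : measurable punctured_ball.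
Proof.
rewrite (_ : punctured_ball = setT `&` enorm @^-1` `]0, 1]%classic).
  exact: measurable_enorm.
by rewrite setTI; apply/seteqP; split => x /=; rewrite in_itv.
Qed.

(* Surface measure on the unit sphere, as d times the Lebesgue measure of the
   cone over a set: by polar coordinates,
   |{x | 0 < |x| <= 1, x / |x| \in A}| = sigma(A) \int_0^1 r^(d-1) dr. *)
Definition surface_measure : {measure set 'rV[R]_d -> \bar R} :=
  mscale (d%:R)%:nng
    (image_measure (mrestr (lebesgue_rV d) measurable_punctured_ball)
                   measurable_normalize).

End euclidean.

Section binary_collision.
Context {R : realType} {d : nat}.
Implicit Types (b psi alpha : R -> R) (v w e : 'rV[R]_d).

Definition bracket v : R := Num.sqrt (1 + enorm v ^+ 2).

Definition post v v1 w : 'rV[R]_d := v + dot w (v1 - v) *: w.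

Definition post1 v v1 w : 'rV[R]_d := v1 - dot w (v1 - v) *: w.

Definition angular_integral b e : \bar R :=
  (\int[surface_measure]_(w in sphere) (b (dot e w))%:E)%E.

Definition axis : 'rV[R]_d := \row_(i < d) ((i : nat) == 0%N)%:R.

(* ||b||: by rotation invariance angular_integral b e is the same for all unit
   vectors e, and [axis] is one of them as soon as d >= 1. *)
Definition angular_norm b : R := fine (angular_integral b axis).

Definition angular_kernel b : Prop :=
  [/\ forall z, -1 <= z <= 1 -> 0 <= b z,
      forall z, -1 <= z <= 1 -> b (- z) = b z,
      lebesgue_measure.-integrable `[-1, 1]
        (fun z : R => (b z * (1 - z ^+ 2) `^ ((d%:R - 3) / 2))%:E)
    & forall e, enorm e = 1 -> (angular_integral b e < +oo)%E].

Definition gain b psi v v1 : \bar R :=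
  (\int[surface_measure]_(w in sphere)
     (b (dot (normalize (v1 - v)) w) *
      (psi (bracket (post v v1 w) ^+ 2) + psi (bracket (post1 v v1 w) ^+ 2)))%:E)%E.

Definition loss b psi v v1 : R :=
  angular_norm b * (psi (bracket v ^+ 2) + psi (bracket v1 ^+ 2)).

Definition collision b psi v v1 : \bar R :=
  (gain b psi v v1 - (loss b psi v v1)%:E)%E.

(* [alpha p] is alpha_p; the index p = k / 2 ranges over the reals p >= 1. *)
Definition binary_coercive_map b alpha : Prop :=
  [/\ forall k l : R, 2 <= k -> k < l -> alpha (l / 2) < alpha (k / 2),
      alpha 1 = angular_norm b,
      alpha (k / 2) @[k --> +oo] --> (0 : R)
    & forall (k : R) v v1, 2 <= k -> v != v1 ->
      (\int[surface_measure]_(w in sphere)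
         (b (dot (normalize (v1 - v)) w) *
          (bracket (post v v1 w) `^ k + bracket (post1 v v1 w) `^ k))%:E
       <= (alpha (k / 2) * (bracket v ^+ 2 + bracket v1 ^+ 2) `^ (k / 2))%:E)%E].

End binary_collision.

Definition tangent_extension {R : realType} (psi : R -> R) (n : nat) (x : R) : R :=
  if x <= n%:R then psi x
  else psi^`()%classic n%:R * x + psi n%:R - n%:R * psi^`()%classic n%:R.

(* Main.v *)
Require Import Defs.
From mathcomp Require Import all_boot all_order all_algebra.
From mathcomp Require Import all_classical all_reals all_analysis.
From mathcomp Require Import ring lra.

(** Write A = <v>^2, B = <v1>^2, p = k/2. Collisions preserve A + B, so the
    coercive map bounds the gain by alpha_p (A + B)^p, and one takes
    Gt = alpha_p ((A + B)^p - A^p - B^p); by convexity this is at most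
    alpha_p p (2 max(A, B))^(p-1) min(A, B), whence the bound.

    For n >= A + B, psi_n agrees with psi on [0, A + B], so the same splitting
    serves and the convergence is eventual equality. For n < A + B one takes the
    positive and negative parts of K_{2,psi_n}: since psi_n(x) / x is
    nondecreasing, the gain is at most psi_n(A + B) / (A + B) times that of the
    identity, hence at most ||b|| psi_n(A + B), and psi_n(A + B) - psi_n(A) -
    psi_n(B) has the same upper bound as for psi because
    psi_n(x) - psi_n(y) <= psi'(x) (x - y). *)

Set Implicit Arguments.
Unset Strict Implicit.
Unset Printing Implicit Defensive.

Import Order.TTheory GRing.Theory Num.Theory.
Import numFieldNormedType.Exports.
Import HBNNSimple.

Local Open Scope classical_set_scope.
Local Open Scope ring_scope.

Lemma max_subr_opp (R : realDomainType) (x : R) :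
  Num.max 0 x - Num.max 0 (- x) = x.
Proof. by case: (leP 0 x) => x0; case: leP; lra. Qed.

(** * Real-variable inequalities for powers and their tangent extensions *)

Section powR_convexity.
Context {R : realType}.
Implicit Types a b p s x y : R.

(* This is Young's inequality for y and x^(p-1). *)
Lemma powR_tangent_le p x y : 1 < p -> 0 <= x -> 0 <= y ->
  x `^ p - y `^ p <= p * x `^ (p - 1) * (x - y).
Proof.
move=> p1 x0 y0; have p0 : 0 < p by lra.
have q0 : 0 < p / (p - 1) by rewrite divr_gt0 ?subr_gt0.
have pq : p^-1 + (p / (p - 1))^-1 = 1.
  by rewrite invf_div -[X in X + _]mul1r -mulrDl addrC subrK divff ?gt_eqF.
have := conjugate_powR y0 (powR_ge0 x (p - 1)) p0 q0 pq.
rewrite -powRrM (_ : (p - 1) * (p / (p - 1)) = p); last by field; lra.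
rewrite -(ler_pM2r p0) invf_div mulrDl divfK ?gt_eqF// -[x `^ p * _ * _]mulrA.
rewrite divfK ?gt_eqF// -{1 2}(mulr_powRB1 x0 p0); lra.
Qed.

Lemma tangent_extension_powRE p n x : 0 < p -> (1 <= n)%N ->
  tangent_extension (fun t : R => t `^ p) n x =
  if x <= n%:R then x `^ p
  else n%:R `^ (p - 1) * (p * x - (p - 1) * n%:R).
Proof.
move=> p0 n1; rewrite /tangent_extension; case: ifP => // _.
rewrite powR_derive1 ?in_itv/= ?andbT ?ltr0n//.
by rewrite -(@mulr_powRB1 _ n%:R p) ?ler0n//; ring.
Qed.

Lemma tangent_extension_powR_ge0 p n x : 1 < p -> (1 <= n)%N ->
  0 <= tangent_extension (fun t : R => t `^ p) n x.
Proof.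
move=> p1 n1; rewrite tangent_extension_powRE//; last by lra.
case: (leP x) => nx; first exact: powR_ge0.
have n0 : 0 <= n%:R :> R by [].
by apply: mulr_ge0; [exact: powR_ge0|nra].
Qed.

(** The extension has slope p min(t, n)^(p-1) at t, which on [y, x] never exceeds p x^(p-1). *)
Lemma tangent_extension_powR_increment p n x y :
  1 < p -> (1 <= n)%N -> 0 <= y <= x ->
  tangent_extension (fun t : R => t `^ p) n x -
  tangent_extension (fun t : R => t `^ p) n y
    <= p * x `^ (p - 1) * (x - y).
Proof.
move=> p1 n1 /andP[y0 yx]; have p0 : 0 < p by lra.
have n0 : 0 <= n%:R :> R by [].
rewrite !tangent_extension_powRE//; case: (leP x) => nx.
  by rewrite (le_trans yx nx); apply: powR_tangent_le => //; lra.
have Nx : n%:R `^ (p - 1) <= x `^ (p - 1).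
  by apply: ge0_ler_powR; rewrite ?nnegrE//; lra.
have {}Nx : p * n%:R `^ (p - 1) * (x - y) <= p * x `^ (p - 1) * (x - y).
  by rewrite ler_wpM2r ?subr_ge0// ler_pM2l.
apply: le_trans Nx; case: (leP y) => ny; last first.
  by rewrite le_eqVlt; apply/orP; left; apply/eqP; ring.
(* For y <= n < x, the tangent inequality at n covers [y, n] with slope p n^(p-1), which is also the
   slope of the affine piece on [n, x]. *)
have := powR_tangent_le p1 n0 y0.
rewrite -(mulr_powRB1 n0 p0); lra.
Qed.

(** The quotient by x is x^(p-1) up to n and n^(p-1) (p - (p-1) n / x) beyond, both nondecreasing
    and equal at n; cross-multiplying allows y = 0. *)
Lemma tangent_extension_powR_slope p n x y :
  1 < p -> (1 <= n)%N -> 0 <= y <= x ->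
  tangent_extension (fun t : R => t `^ p) n y * x <=
  tangent_extension (fun t : R => t `^ p) n x * y.
Proof.
move=> p1 n1 /andP[y0 yx]; have p0 : 0 < p by lra.
have x0 := le_trans y0 yx.
have n0 : 0 <= n%:R :> R by [].
have pow_le s t : 0 <= s <= t -> s `^ (p - 1) <= t `^ (p - 1).
  by move=> /andP[s0 st]; apply: ge0_ler_powR; rewrite ?nnegrE//; lra.
have N0 := powR_ge0 (n%:R : R) (p - 1).
rewrite !tangent_extension_powRE//; case: (leP x) => nx.
  rewrite (le_trans yx nx) -!(@mulr_powRB1 _ _ p)//.
  rewrite mulrAC [leRHS]mulrAC [x * y]mulrC.
  by apply: ler_wpM2l; [exact: mulr_ge0|apply: pow_le; rewrite y0].
case: (leP y) => ny; last first.
  rewrite -!mulrA; apply: ler_wpM2l => //.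
  have : 0 <= (p - 1) * n%:R * (x - y) by rewrite !mulr_ge0// subr_ge0// ltW.
  by lra.
rewrite -(mulr_powRB1 y0 p0).
apply: (@le_trans _ _ (y * n%:R `^ (p - 1) * x)).
  by apply: ler_wpM2r => //; apply: ler_wpM2l => //; apply: pow_le; rewrite y0.
rewrite [y * _]mulrC -!mulrA; apply: ler_wpM2l => //.
rewrite [leRHS]mulrC; apply: ler_wpM2l => //.
have : 0 <= (p - 1) * (x - n%:R) by rewrite mulr_ge0// subr_ge0 ltW.
by lra.
Qed.

(** Split off one factor: (x+y)^p = (x+y) (x+y)^(p-1), and the last power dominates x^(p-1) and
    y^(p-1). *)
Lemma powR_superadditive p x y : 1 < p -> 0 <= x -> 0 <= y ->
  x `^ p + y `^ p <= (x + y) `^ p.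
Proof.
move=> p1 x0 y0; have p0 : 0 < p by lra.
rewrite -!(@mulr_powRB1 _ _ p) ?addr_ge0// mulrDl.
by apply: lerD; apply: ler_wpM2l => //; apply: ge0_ler_powR;
  rewrite ?nnegrE//; lra.
Qed.

(** Keeping [phi] abstract lets the power and all its tangent extensions share one constant, hence
    the same C_k. *)
Lemma cross_term_bound (phi : R -> R) p a b : 1 < p ->
  (forall x, 0 <= x -> 0 <= phi x) ->
  (forall x y, 0 <= y <= x -> phi x - phi y <= p * x `^ (p - 1) * (x - y)) ->
  0 <= a -> 0 <= b ->
  phi (a ^+ 2 + b ^+ 2) - (phi (a ^+ 2) + phi (b ^+ 2)) <=
  p * 2 `^ (p - 1) *
    (a * b * (a `^ (2 * p - 2) + b `^ (2 * p - 2))).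
Proof.
move=> p1 phi_ge0 phi_incr.
wlog ba : a b / b <= a => [hw a0 b0|a0 b0].
  have [ba|/ltW ab] := leP b a; first exact: hw.
  rewrite [a ^+ 2 + _]addrC [phi _ + phi _]addrC [a * b]mulrC [a `^ _ + _]addrC.
  exact: hw.
have p0 : 0 < p by lra.
have a20 : 0 <= a ^+ 2 by rewrite exprn_ge0.
have b20 : 0 <= b ^+ 2 by rewrite exprn_ge0.
have ab2 : b ^+ 2 <= a ^+ 2 by rewrite lerXn2r.
have powE : (a ^+ 2) `^ (p - 1) = a `^ (2 * p - 2).
  by rewrite -powR_mulrn// -powRrM mulrBr mulr1.
(* Drop phi(b^2) >= 0 and bound the increment from a^2 to a^2 + b^2. *)
apply: (@le_trans _ _ (p * (a ^+ 2 + b ^+ 2) `^ (p - 1) * b ^+ 2)).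
  have := phi_incr (a ^+ 2 + b ^+ 2) (a ^+ 2).
  have -> : a ^+ 2 + b ^+ 2 - a ^+ 2 = b ^+ 2 by ring.
  by rewrite a20 lerDl b20 => /(_ isT); have := phi_ge0 _ b20; lra.
(* Since b <= a, a^2 + b^2 <= 2 a^2 and b^2 <= a b. *)
apply: (@le_trans _ _ (p * (2 `^ (p - 1) * a `^ (2 * p - 2)) * (a * b))).
  apply: ler_pM => //; last by rewrite expr2 ler_wpM2r.
    by rewrite mulr_ge0 ?powR_ge0// ltW.
  rewrite ler_pM2l// -powE -powRM//.
  by apply: ge0_ler_powR; rewrite ?nnegrE; lra.
rewrite -!mulrA ler_pM2l//; apply: ler_wpM2l; first exact: powR_ge0.
rewrite mulrC -!mulrA; apply: ler_wpM2l => //; apply: ler_wpM2l => //.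
by rewrite lerDl powR_ge0.
Qed.

End powR_convexity.

(* No measurability is assumed: comparing the suprema over simple functions is
   enough. *)
Lemma ge0_integral_le_scale d (T : measurableType d) (R : realType)
    (mu : {measure set T -> \bar R}) (D : set T) (f g : T -> R) (c : R) :
  0 <= c -> (forall x, D x -> 0 <= f x) -> (forall x, D x -> 0 <= g x) ->
  (forall x, D x -> f x <= c * g x) ->
  (\int[mu]_(x in D) (f x)%:E <= c%:E * \int[mu]_(x in D) (g x)%:E)%E.
Proof.
rewrite le_eqVlt => /predU1P[<- f0 g0 fg|c0 f0 g0 fg].
  rewrite mul0e integral0_eq// => x Dx; congr EFin; apply/eqP.
  by rewrite eq_le f0// andbT; have := fg _ Dx; rewrite mul0r.
have fE x : D x -> (0 <= (f x)%:E)%E by rewrite lee_fin; exact: f0.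
have gE x : D x -> (0 <= (g x)%:E)%E by rewrite lee_fin; exact: g0.
rewrite (ge0_integralE mu fE) (ge0_integralE mu gE).
apply: ge_ereal_sup => _ [h /= hf <-].
have ci0 : 0 <= c^-1 by rewrite invr_ge0 ltW.
rewrite -lee_pdivrMl// -sintegralrM.
(* The simple function h / c lies below g on D; off D the integrand is extended by 0, so h <= 0
   there and scaling preserves this. *)
apply: ereal_sup_ubound; exists (scale_nnsfun h ci0) => //= x.
move: (hf x); rewrite /patch; case: ifPn => [/set_mem Dx|_].
  by rewrite !lee_fin mulrC ler_pdivrMr// mulrC => /le_trans; apply; exact: fg.
by rewrite !lee_fin => hx; rewrite mulr_ge0_le0.
Qed.

(** * Inner products, brackets and conservation of energy *)

Section collision_geometry.
Context {R : realType} {d : nat}.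
Implicit Types (u v w e : 'rV[R]_d) (s : R).

Lemma dotC u v : dot u v = dot v u.
Proof. by apply: eq_bigr => i _; rewrite mulrC. Qed.

Lemma dotDl u v w : dot (u + v) w = dot u w + dot v w.
Proof.
by rewrite /dot -big_split; apply: eq_bigr => i _; rewrite mxE mulrDl.
Qed.

Lemma dotZl s u v : dot (s *: u) v = s * dot u v.
Proof.
by rewrite /dot big_distrr; apply: eq_bigr => i _; rewrite mxE -mulrA.
Qed.

Lemma dotDr u v w : dot w (u + v) = dot w u + dot w v.
Proof. by rewrite dotC dotDl !(dotC w). Qed.

Lemma dotZr s u v : dot v (s *: u) = s * dot v u.
Proof. by rewrite dotC dotZl (dotC v). Qed.

Lemma dot_ge0 v : 0 <= dot v v.
Proof. by apply: sumr_ge0 => i _; rewrite -expr2 sqr_ge0. Qed.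

Lemma dot_eq0 v : (dot v v == 0) = (v == 0).
Proof.
apply/idP/eqP => [|->]; last first.
  by apply/eqP; rewrite /dot big1// => i _; rewrite mxE mul0r.
rewrite /dot psumr_eq0 => [/allP v0|i _]; last by rewrite -expr2 sqr_ge0.
apply/rowP => i; rewrite mxE; apply/eqP.
by have := v0 i (mem_index_enum _); rewrite -expr2 sqrf_eq0.
Qed.

Lemma sqr_enorm v : enorm v ^+ 2 = dot v v.
Proof. by rewrite sqr_sqrtr// dot_ge0. Qed.

Lemma sqr_bracket v : bracket v ^+ 2 = 1 + dot v v.
Proof. by rewrite sqr_sqrtr sqr_enorm// addr_ge0// dot_ge0. Qed.

Lemma bracket_ge0 v : 0 <= bracket v.
Proof. exact: sqrtr_ge0. Qed.

Lemma enorm_normalize v : v != 0 -> enorm (normalize v) = 1.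
Proof.
rewrite -dot_eq0 => v0; have n0 : 0 < dot v v by rewrite lt_def v0 dot_ge0.
rewrite /enorm dotZl dotZr mulrA -expr2 exprVn sqr_enorm.
by rewrite mulVf// sqrtr1.
Qed.

(** Expand |u + v|^2 >= 0 and |u - v|^2 >= 0. This keeps the argument of the angular kernel in
    [-1, 1], where its sign is known. *)
Lemma dot_unit_le1 u v : enorm u = 1 -> enorm v = 1 -> -1 <= dot u v <= 1.
Proof.
move=> u1 v1.
have uu : dot u u = 1 by rewrite -sqr_enorm u1 expr1n.
have vv : dot v v = 1 by rewrite -sqr_enorm v1 expr1n.
have := dot_ge0 (u + v); have := dot_ge0 (u + (-1) *: v).
rewrite !(dotDl, dotDr, dotZl, dotZr) (dotC v u) uu vv; lra.
Qed.

(** With s the inner product of w and v1 - v, the cross terms contribute -2 s^2 and the two squares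
    2 s^2 |w|^2. *)
Lemma post_energy v v1 w : enorm w = 1 ->
  bracket (post v v1 w) ^+ 2 + bracket (post1 v v1 w) ^+ 2 =
  bracket v ^+ 2 + bracket v1 ^+ 2.
Proof.
move=> w1; have ww : dot w w = 1 by rewrite -sqr_enorm w1 expr1n.
rewrite !sqr_bracket /post /post1 -[v1 - v]/(v1 + - v) -(scaleN1r v).
rewrite -scaleNr !(dotDl, dotDr, dotZl, dotZr) (dotC v w) (dotC v1 w) ww; ring.
Qed.

Lemma post_le_energy v v1 w (S := bracket v ^+ 2 + bracket v1 ^+ 2) :
  enorm w = 1 ->
  0 <= bracket (post v v1 w) ^+ 2 <= S /\ 0 <= bracket (post1 v v1 w) ^+ 2 <= S.
Proof.
by move=> /(post_energy v v1); rewrite /S => <-;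
  rewrite lerDl lerDr !exprn_ge0 ?bracket_ge0.
Qed.

End collision_geometry.

(** * Consequences of the coercive map for the gain term *)

Section gain_estimates.
Context {R : realType} {d : nat} (b alpha : R -> R).
Hypothesis bK : angular_kernel (d := d) b.
Hypothesis bA : binary_coercive_map (d := d) b alpha.
Implicit Types (v w : 'rV[R]_d) (phi : R -> R).

Let b_ge0 v (v1 : 'rV[R]_d) w : v1 - v != 0 -> enorm w = 1 ->
  0 <= b (dot (normalize (v1 - v)) w).
Proof.
case: bK => b0 _ _ _ u0 w1; apply/b0/dot_unit_le1 => //.
exact: enorm_normalize.
Qed.

(** Decreasing to the limit 0 makes the map nonnegative at p + 1/2, and strictness makes it positive
    at p. *)
Lemma coercive_map_gt0 p : 1 <= p -> 0 < alpha p.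
Proof.
case: bA => decr _ lim _ p1.
have -> : p = 2 * p / 2 by field.
apply: (@le_lt_trans _ _ (alpha ((2 * p + 1) / 2))); last by apply: decr; lra.
apply: (cvgr_to_le lim); near=> l; apply/ltW/decr; first by lra.
by near: l; apply: nbhs_pinfty_gt; exact: num_real.
Unshelve. all: by end_near. Qed.

Lemma coercive_map_le p : 1 <= p -> alpha p <= angular_norm (d := d) b.
Proof.
case: bA => decr <- _ _; rewrite le_eqVlt => /predU1P[<-//|p1].
have -> : p = 2 * p / 2 by field.
by rewrite -[X in _ <= alpha X](@divff _ 2)//; apply/ltW/decr; lra.
Qed.

Lemma gain_ge0 phi v (v1 : 'rV[R]_d) :
  v1 - v != 0 -> (forall x, 0 <= x -> 0 <= phi x) ->
  (0 <= gain b phi v v1)%E.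
Proof.
move=> u0 phi0; apply: integral_ge0 => w w1; rewrite lee_fin.
by rewrite mulr_ge0 ?b_ge0// addr_ge0// phi0// exprn_ge0 ?bracket_ge0.
Qed.

Lemma gain_powR_le p v (v1 : 'rV[R]_d) : v1 - v != 0 -> 1 <= p ->
  (gain b (fun x : R => x `^ p)%R v v1 <=
   (alpha p * (bracket v ^+ 2 + bracket v1 ^+ 2) `^ p)%:E)%E.
Proof.
move=> u0 p1; case: bA => _ _ _ /(_ (2 * p) v v1).
rewrite (_ : 2 * p / 2 = p); last by field.
rewrite eq_sym -subr_eq0 u0 => /(_ _ isT); rewrite ler_peMr// => /(_ isT).
apply: le_trans; rewrite le_eqVlt; apply/orP; left; apply/eqP.
apply: eq_integral => w _; rewrite !(powRrM _ 2).
by rewrite !powR_mulrn ?bracket_ge0.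
Qed.

(* The coercive map at k = 2 bounds the gain of the energy by
   ||b|| (<v>^2 + <v1>^2); no rotation invariance of the angular integral is
   needed. *)
Lemma gain_slope_le phi v (v1 : 'rV[R]_d)
    (S := bracket v ^+ 2 + bracket v1 ^+ 2) :
  v1 - v != 0 -> (forall x, 0 <= x -> 0 <= phi x) ->
  (forall x y, 0 <= y <= x -> phi y * x <= phi x * y) ->
  (gain b phi v v1 <= (angular_norm (d := d) b * phi S)%:E)%E.
Proof.
move=> u0 phi0 slope.
have S0 : 0 < S.
  by rewrite /S !sqr_bracket; have := dot_ge0 v; have := dot_ge0 v1; lra.
have := gain_powR_le u0 (lexx 1).
rewrite (powRr1 (ltW S0)); case: bA => _ -> _ _ gain1.
have c0 : 0 <= phi S / S by rewrite divr_ge0 ?phi0// ltW.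
have -> : (angular_norm (d := d) b * phi S)%:E =
  ((phi S / S)%:E * (angular_norm (d := d) b * S)%:E)%E.
  by rewrite -EFinM; congr EFin; field; rewrite gt_eqF.
apply: le_trans (lee_wpmul2l _ gain1); last by rewrite lee_fin.
apply: ge0_integral_le_scale => // w w1.
- by rewrite mulr_ge0 ?b_ge0// addr_ge0// phi0// exprn_ge0 ?bracket_ge0.
- by rewrite mulr_ge0 ?b_ge0// addr_ge0// powR_ge0.
rewrite mulrCA; apply: ler_wpM2l; first exact: b_ge0.
(* The chord from 0 to S dominates [phi]; the exponent 1 matches the integrand of the coercive bound
   at k = 2. *)
have slopeS y : 0 <= y <= S -> phi y <= phi S / S * y `^ 1.
  move=> yS; have /andP[y0 _] := yS.
  by rewrite powRr1// mulrAC ler_pdivlMr// slope.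
have [xS yS] := post_le_energy v v1 w1.
by rewrite mulrDr; apply: lerD; exact: slopeS.
Qed.

(** By energy conservation both post-collisional energies stay in [0, <v>^2 + <v1>^2]. *)
Lemma eq_gain phi psi v (v1 : 'rV[R]_d) :
  (forall x, 0 <= x <= bracket v ^+ 2 + bracket v1 ^+ 2 -> phi x = psi x) ->
  gain b phi v v1 = gain b psi v v1.
Proof.
move=> eq_phi; apply: eq_integral => w; rewrite inE => w1.
by have [xS yS] := post_le_energy v v1 w1; rewrite !eq_phi.
Qed.

End gain_estimates.

(** * Assembly of the decompositions for the power and its tangent extensions *)

Theorem lemma3p2 (R : realType) (k : R) (hk : 2 < k) :
  exists C : R, 1 < C /\
  forall (d : nat) (b alpha : R -> R),
    (2 <= d)%N ->
    angular_kernel (d := d) b ->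
    binary_coercive_map (d := d) b alpha ->
    let psi := (fun x : R => x `^ (k / 2)) in
    let normb := angular_norm (d := d) b in
    let bound := (fun v v1 : 'rV[R]_d =>
      C * (bracket v * bracket v1 *
           (bracket v `^ (k - 2) + bracket v1 `^ (k - 2)))) in
    exists (Gt Lt : 'rV[R]_d -> 'rV[R]_d -> R)
           (Gtn Ltn : nat -> 'rV[R]_d -> 'rV[R]_d -> R),
      (forall v v1 : 'rV[R]_d, v1 - v != 0 ->
        [/\ collision b psi v v1 = (Gt v v1 - Lt v v1)%:E,
            0 <= Gt v v1 <= alpha (k / 2) * bound v v1
          & (normb - alpha (k / 2)) * (bracket v `^ k + bracket v1 `^ k)
            <= Lt v v1]) /\
      (forall v v1 : 'rV[R]_d, v1 - v != 0 ->
        (forall n : nat, (1 <= n)%N ->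
          [/\ collision b (tangent_extension psi n) v v1
                = (Gtn n v v1 - Ltn n v v1)%:E,
              0 <= Gtn n v v1 <= normb * bound v v1
            & 0 <= Ltn n v v1]) /\
        Ltn n v v1 @[n --> \oo] --> Lt v v1).
Proof.
pose p := k / 2; have kE : k = 2 * p by rewrite /p; field.
have p1 : 1 < p by lra.
have p0 : 0 <= p by lra.
have p2 : 0 <= p * 2 `^ (p - 1) by rewrite mulr_ge0 ?powR_ge0.
(* The second summand is the cross-term constant; adding 1 makes C_k > 1 immediate. *)
exists (1 + p * 2 `^ (p - 1)); split.
  by rewrite ltrDl mulr_gt0 ?powR_gt0//; lra.
move=> d b alpha _ bK bA psi normb bound.
(* The upper bound transfers the estimates for [psi] to the extensions with S <= n, including the
   sign of their loss part. *)
have [alpha0 alphab] : 0 < alpha p /\ alpha p <= normb.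
  by split; [apply: (coercive_map_gt0 bA)|apply: (coercive_map_le bA)];
    exact: ltW.
have sqr0 (v : 'rV[R]_d) : 0 <= bracket v ^+ 2.
  by rewrite exprn_ge0 ?bracket_ge0.
pose S (v v1 : 'rV[R]_d) := bracket v ^+ 2 + bracket v1 ^+ 2.
pose cross (phi : R -> R) v v1 :=
  phi (S v v1) - (phi (bracket v ^+ 2) + phi (bracket v1 ^+ 2)).
have cross_le (phi : R -> R) v v1 : (forall x, 0 <= x -> 0 <= phi x) ->
    (forall x y, 0 <= y <= x -> phi x - phi y <= p * x `^ (p - 1) * (x - y)) ->
    cross phi v v1 <= bound v v1.
  move=> phi0 phi_incr.
  have := cross_term_bound p1 phi0 phi_incr (bracket_ge0 v) (bracket_ge0 v1).
  move=> /le_trans; apply.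
  rewrite /bound kE ler_wpM2r ?lerDr//.
  by rewrite !mulr_ge0 ?bracket_ge0// addr_ge0// powR_ge0.
have psi_ge0 x : 0 <= x -> 0 <= psi x by move=> _; exact: powR_ge0.
have psin_ge0 n x : (1 <= n)%N -> 0 <= x -> 0 <= tangent_extension psi n x.
  by move=> n1 _; exact: tangent_extension_powR_ge0.
(* Finiteness ensures that [fine] below returns the true gain and not its default value. *)
have gain_fin (phi : R -> R) (v v1 : 'rV[R]_d) (M : R) : v1 - v != 0 ->
    (forall x, 0 <= x -> 0 <= phi x) -> (gain b phi v v1 <= M%:E)%E ->
    gain b phi v v1 \is a fin_num.
  move=> u0 phi0 gM; rewrite ge0_fin_numE; last exact: (gain_ge0 bK u0 phi0).
  exact: le_lt_trans gM (ltry _).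
pose Gt (v v1 : 'rV[R]_d) := alpha p * cross psi v v1.
(* Solved from the required identity, so only the lower bound on [Lt] needs the coercive
   estimate. *)
pose Lt (v v1 : 'rV[R]_d) := loss b psi v v1 + Gt v v1 - fine (gain b psi v v1).
pose K n (v v1 : 'rV[R]_d) := fine (gain b (tangent_extension psi n) v v1)
  - loss b (tangent_extension psi n) v v1.
have psi_cross_ge0 v v1 : 0 <= cross psi v v1.
  by rewrite subr_ge0; exact: powR_superadditive.
have psi_cross_le v v1 : cross psi v v1 <= bound v v1.
  apply: cross_le => // x y /andP[y0 yx].
  by apply: powR_tangent_le => //; exact: le_trans yx.
have psiP (v v1 : 'rV[R]_d) : v1 - v != 0 ->
    [/\ collision b psi v v1 = (Gt v v1 - Lt v v1)%:E,
        0 <= Gt v v1 <= alpha p * bound v v1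
      & (normb - alpha p) * (bracket v `^ k + bracket v1 `^ k) <= Lt v v1].
  move=> u0; have gain_le := gain_powR_le bA u0 (ltW p1).
  have gfin := gain_fin _ _ _ _ u0 psi_ge0 gain_le.
  rewrite -(fineK gfin) lee_fin in gain_le.
  split.
  - by rewrite /collision -(fineK gfin) -EFinB; congr EFin; rewrite /Lt; ring.
  - by rewrite /Gt mulr_ge0//= ?ler_pM2l// ltW.
  - have powE (w : 'rV[R]_d) : bracket w `^ k = psi (bracket w ^+ 2).
      by rewrite kE powRrM powR_mulrn ?bracket_ge0.
    move: gain_le; rewrite !powE -[_ `^ p]/(psi (S v v1)) /Lt /Gt /cross /loss.
    (* Once the terms with ||b|| cancel, the claim is exactly gain <= alpha_p S^p. *)
    move: (fine _) (psi (S v v1)) (psi (_ v ^+ 2)) (psi (_ v1 ^+ 2)).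
    by rewrite -/normb => g s x y; clear; lra.
exists Gt, Lt,
  (fun n v v1 => if S v v1 <= n%:R then Gt v v1 else Num.max 0 (K n v v1)),
  (fun n v v1 => if S v v1 <= n%:R then Lt v v1 else Num.max 0 (- K n v v1)).
split=> [v v1 u0|v v1 u0]; first exact: psiP.
have [psi_coll /andP[Gt0 Gt_le] Lt_ge] := psiP _ _ u0.
have bound0 := le_trans (psi_cross_ge0 v v1) (psi_cross_le v v1).
split=> [n n1|]; last first.
  apply: cvg_near_cst; near=> n; rewrite ifT//.
  by near: n; exact: nbhs_infty_ger.
case: ifPn => [Sn|_].
  have eq_psin x : 0 <= x <= S v v1 -> tangent_extension psi n x = psi x.
    by move=> /andP[_ xS]; rewrite /tangent_extension (le_trans xS Sn).
  split.
  - rewrite -psi_coll /collision (eq_gain _ eq_psin); congr (_ - (_)%:E)%E.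
    by rewrite /loss !eq_psin// sqr0/= ?lerDl ?lerDr.
  - by rewrite Gt0 (le_trans Gt_le)// ler_wpM2r.
  - by apply: le_trans Lt_ge; rewrite mulr_ge0 ?subr_ge0// addr_ge0// powR_ge0.
have psin0 x := @psin_ge0 n x n1.
have gain_le := gain_slope_le bK bA u0 psin0
  (fun x y => tangent_extension_powR_slope p1 n1).
have gfin := gain_fin _ _ _ _ u0 psin0 gain_le.
rewrite -(fineK gfin) lee_fin in gain_le.
split; last by rewrite le_max lexx.
- rewrite /collision -(fineK gfin) -EFinB -/(K n v v1); congr EFin.
  by rewrite max_subr_opp.
(* It remains to bound [K] itself: gain <= ||b|| psi_n(S) gives at most ||b|| times the cross term
   of psi_n. *)
- rewrite le_max lexx /= ge_max mulr_ge0//=; last first.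
    exact: ltW (lt_le_trans alpha0 alphab).
  have := cross_le _ v v1 psin0
    (fun x y => tangent_extension_powR_increment p1 n1).
  move=> /(ler_wpM2l (ltW (lt_le_trans alpha0 alphab))); apply: le_trans.
  by rewrite /cross mulrBr lerB.
Unshelve. all: by end_near. Qed.
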